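(* Let $f$ be a probability density on $\mathbb R$, strictly positive on its domain $D\subset\mathbb R$, and let $q(y)$ be a probability density on $D$, positive on $D$. If there is a constant $a>0$ such that $q(y)\ge a f(y)$ for almost all $y$, then the independent Metropolis-Hastings algorithm with proposal $q$ and invariant density $f$ generates a geometrically ergodic and exponentially $\rho$-mixing Markov chain.
   Context: The Metropolis-Hastings algorithm with proposal $q(x,y)$ (a probability density in $y\in D$ for each $x\in D$) and invariant density $f$ is the Markov chain on $D$ with transition kernel $$P(x,dy)=q(x,y)\alpha(x,y)\,dy+\Big(1-\int q(x,y)\alpha(x,y)\,dy\Big)\delta_x(dy),\qquad \alpha(x,y)=\min\Big\{\frac{f(y)q(y,x)}{f(x)q(x,y)},1\Big\},$$ where $\delta_x$ is the point mass at $x$. The independent Metropolis-Hastings algorithm is the case in which the proposal does not depend on the current state, $q(x,y)=q(y)$. Mixing properties refer to the stationary chain $(X_n)_{n\in\mathbb Z}$, whose marginal density is $f$. For $\sigma$-fields $\mathscr A,\mathscr B$ put $\rho(\mathscr A,\mathscr B)=\sup\{\mathrm{corr}(g,h): g\in L^2(\mathscr A), h\in L^2(\mathscr B)\}$, and $\rho_n=\rho(\sigma(X_i,i\le0),\sigma(X_i,i\ge n))$. The chain is exponentially $\rho$-mixing if $\rho_n\le K r^n$ for all $n\ge1$ for some $K<\infty$, $r\in(0,1)$. The chain is geometrically ergodic if there are $b\in(0,1)$ and a function $W$ with $\mathbb E(W(X_0))<\infty$ such that for all $n\in\mathbb N$ and almost every $x$, $\sup_{B}|P(X_n\in B|X_0=x)-P(X_n\in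 B)|\le b^nW(x)$, the supremum being over Borel sets $B$; this is equivalent to exponential $\beta$-mixing, i.e. exponential decay of $\beta_n=\mathbb E\sup_{B\in\mathscr B}|P(B|\mathscr A)-P(B)|$ with $\mathscr A=\sigma(X_i,i\le0)$, $\mathscr B=\sigma(X_i,i\ge n)$. *)

(* Defs.v *)
From HB Require Import structures.
From mathcomp Require Import all_boot all_order all_algebra.
From mathcomp Require Import all_classical all_reals all_analysis.

Set Implicit Arguments.
Unset Strict Implicit.
Unset Printing Implicit Defensive.

Import Order.TTheory GRing.Theory Num.Theory.
Import numFieldNormedType.Exports.

Local Open Scope classical_set_scope.
Local Open Scope ring_scope.

(* A probability density that is strictly positive on its domain [D]; it is
   extended by [0] to the whole line, so that integrals over [D] and over the
   line coincide. *)
Definition positive_density_on (R : realType) (D : set R) (g : R -> R) : Prop :=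
  [/\ measurable_fun setT g,
      forall x, D x -> 0 < g x,
      forall x, ~ D x -> g x = 0 &
      (\int[@lebesgue_measure R]_x (g x)%:E = 1)%E].

(* The quotient is [0] when [f x * q x y = 0]; for [x] in the domain of [f]
   this only happens where [q x y = 0], hence has no effect on [mh_kernel]. *)
Definition mh_acceptance (R : realType) (f : R -> R) (q : R -> R -> R)
    (x y : R) : R :=
  Num.min ((f y * q y x) / (f x * q x y)) 1.

Definition mh_kernel (R : realType) (f : R -> R) (q : R -> R -> R)
    (x : R) (B : set R) : \bar R :=
  (\int[@lebesgue_measure R]_(y in B) (q x y * mh_acceptance f q x y)%:E
   + (1 - \int[@lebesgue_measure R]_y (q x y * mh_acceptance f q x y)%:E)
     * \d_x B)%E.

Definition independent_mh_kernel (R : realType) (f q : R -> R) :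
    R -> set R -> \bar R :=
  mh_kernel f (fun _ y => q y).

Section Processes.
Context d (T : measurableType d) (R : realType) (P : probability T R).
Implicit Type X : int -> {RV P >-> R}.

Definition sigma_of X (I : set int) : set (set T) :=
  <<s \bigcup_(i in I) preimage_set_system setT (X i) measurable >>.

(* [X] is Markov with respect to its natural filtration, with one-step
   transition kernel [K], and every [X n] has density [f]; these two conditions
   determine the law of [X] and make it strictly stationary. *)
Definition stationary_markov_chain (K : R -> set R -> \bar R) (f : R -> R) X
    : Prop :=
  (forall n : int, forall (A : set T) (B : set R),
     sigma_of X [set i | i <= n] A -> measurable B ->
     P (A `&` X (n + 1) @^-1` B) = (\int[P]_(w in A) K (X n w) B)%E) /\
  (forall n : int, forall B : set R, measurable B ->
     distribution P (X n) B = (\int[@lebesgue_measure R]_(y in B) (f y)%:E)%E).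

(* [k x B] is a regular version of [P (Z \in B | Y = x)]. *)
Definition regular_conditional_distribution (Y Z : {RV P >-> R})
    (k : R.-pker R ~> R) : Prop :=
  forall A B : set R, measurable A -> measurable B ->
    P (Y @^-1` A `&` Z @^-1` B) =
    (\int[distribution P Y]_(x in A) k x B)%E.

(* Regular versions of [P (X n \in . | X 0 = x)] agree for almost every [x],
   simultaneously for all Borel sets, so the choice of [k] is immaterial. *)
Definition geometrically_ergodic X : Prop :=
  exists (b : R) (W : R -> R),
    [/\ 0 < b < 1,
        measurable_fun setT W,
        forall x, 0 <= W x,
        ('E_P[W \o X 0%R] < +oo)%E &
        forall n : nat,
          exists2 k : R.-pker R ~> R,
            regular_conditional_distribution (X 0) (X n%:Z) k &
            {ae distribution P (X 0), forall x,
              (ereal_sup [set `|k x B - P (X n%:Z @^-1` B)|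
                         | B in (measurable : set (set R))]
               <= (b ^+ n * W x)%R%:E)%E}].

Definition L2_sub (G : set (set T)) : set (T -> R) :=
  [set g | preimage_set_system setT g measurable `<=` G /\
           g \in Lfun P 2%:E].

(* Equal to [0] if one of the variances vanishes. *)
Definition correlation (g h : T -> R) : R :=
  fine (covariance P g h) /
  (Num.sqrt (fine 'V_P[g]) * Num.sqrt (fine 'V_P[h])).

Definition rho (G H : set (set T)) : \bar R :=
  ereal_sup [set (correlation g h)%:E | g in L2_sub G & h in L2_sub H].

Definition rho_coef X (n : nat) : \bar R :=
  rho (sigma_of X [set i | i <= 0]) (sigma_of X [set i | n%:Z <= i]).

Definition exponentially_rho_mixing X : Prop :=
  exists K r : R, 0 < r < 1 /\
    forall n : nat, (1 <= n)%N -> (rho_coef X n <= (K * r ^+ n)%R%:E)%E.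

End Processes.

(* Main.v *)
Require Import Defs.
From HB Require Import structures.
From mathcomp Require Import all_boot all_order all_algebra.
From mathcomp Require Import all_classical all_reals all_analysis.
From mathcomp Require Import measurable_realfun.
From mathcomp Require Import ring lra.

(** The chain satisfies a Doeblin condition.  If [f x > 0] and
    [a * f x <= q x], then for every [y] with [a * f y <= q y] the density of
    an accepted move from [x] to [y] is
    [min (f y * q x / f x) (q y) >= a * f y]; almost every point is of this
    kind, so [K x >= a * pi] for the invariant law [pi] and [pi]-almost every
    [x].  Changing the kernel on the null set of bad starting points does not
    change the chain, since it never visits them almost surely, and makes the
    bound hold everywhere ([mh_chain_doeblin]).  One may also lower [a] so that
    [a < 1].

    Iterating the bound gives [K^n x >= (1 - (1 - a)^n) * pi]
    ([doeblin_minorization]).  Applied to a set and to its complement, this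
    one-sided estimate already says that [K^n x] and [pi] differ by at most
    [(1 - a)^n] on every set; [K^n] is a regular version of the law of [X n]
    given [X 0], so the chain is geometrically ergodic with a constant [W].

    For the mixing coefficient, the Markov property turns the estimate on
    [K^n] into
    [(1 - (1 - a)^n) * P A * P H <= P (A `&` H)]
    for all events [A] of the past up to time [0] and all events [H] of the
    future from time [n] on ([past_future_lower_bound]).  The point is that the
    conditional probability of [H] given the past up to time [n] is a function
    of [X n]; this is clear for cylinders and passes to the generated
    sigma-algebra by Dynkin's argument.

    Finally, a lower bound [(1 - eps) * P A * P B <= P (A `&` B)] between two
    sigma-algebras forces their maximal correlation to be at most [eps]
    ([rho_le_of_lower_bound]): what is left of the joint law after removing
    [1 - eps] times the product law is a positive measure of mass [eps] with
    marginals [eps * P], and the inequality [2 u v <= u^2 + v^2] integrated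
    against it bounds the covariance.  In the proof this becomes the comparison
    of [(u - v)^2] under the two laws. *)

Set Implicit Arguments.
Unset Strict Implicit.
Unset Printing Implicit Defensive.

Import Order.TTheory GRing.Theory Num.Theory.
Import numFieldNormedType.Exports.

Local Open Scope classical_set_scope.
Local Open Scope ring_scope.

(** * Integrals against comparable measures and mixtures *)

Section MeasureIntegrals.
Context d d' (T : measurableType d) (Y : measurableType d') (R : realType).
Local Open Scope ereal_scope.

Lemma le_scale_measure_integral (c : {nonneg R})
    (mu nu : {measure set Y -> \bar R}) (f : Y -> \bar R) :
  (forall B, measurable B -> c%:num%:E * mu B <= nu B) ->
  measurable_fun [set: Y] f -> (forall y, 0 <= f y) ->
  c%:num%:E * \int[mu]_y f y <= \int[nu]_y f y.
Proof.
move=> le_mu_nu mf f0.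
rewrite -ge0_integral_mscale//.
exact: ge0_le_measure_integral.
Qed.

Import HBNNSimple.

(** Fubini for a mixture of measures: it holds by hypothesis for indicators,
    hence for simple functions, and then by monotone convergence.  With
    the kernel at the random state [X n] it lets the Markov property, assumed for events, be used
    with functions; with a Dirac [K] it is a change of variables. *)
Lemma integral_mixture (mu : {measure set T -> \bar R}) (D : set T)
    (K : T -> {measure set Y -> \bar R}) (nu : {measure set Y -> \bar R})
    (f : Y -> \bar R) :
  measurable D ->
  (forall B, measurable B -> measurable_fun [set: T] (K ^~ B)) ->
  (forall B, measurable B -> nu B = \int[mu]_(x in D) K x B) ->
  measurable_fun [set: Y] f -> (forall y, 0 <= f y) ->
  \int[nu]_y f y = \int[mu]_(x in D) \int[K x]_y f y.
Proof.
move=> mD mK nuE mf f0.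
have nnsfunE (h : {nnsfun Y >-> R}) :
    \int[nu]_y (h y)%:E = \int[mu]_(x in D) \int[K x]_y (h y)%:E.
  under [RHS]eq_integral do rewrite integralT_nnsfun sintegralE.
  rewrite integralT_nnsfun sintegralE ge0_integral_fsum//; last 2 first.
  - by move=> r; apply: measurable_funeM; exact/measurable_funTS/mK.
  - move=> r x _; have := mulemu_ge0 (fun r => h @^-1` [set r]).
    by apply; exact: preimage_nnfun0.
  apply: eq_fsbigr => r _.
  have mfiber := measurable_sfunP h (measurable_set1 r).
  have mK_fiber := measurable_funTS (D := D) (mK _ mfiber).
  have [r0|r0] := leP 0%R r; first by rewrite nuE// ge0_integralZl.
  rewrite preimage_nnfun0// measure0 mule0 integral0_eq// => x _.
  by rewrite measure0 mule0.
pose h := nnsfun_approx measurableT mf.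
have mh n : measurable_fun [set: Y] (fun y => (h n y)%:E).
  exact/measurable_EFinP.
have h0 n y : 0 <= (h n y)%:E by rewrite lee_fin.
have ndh y : {homo (fun n => (h n y)%:E) : m n / (m <= n)%N >-> m <= n}.
  by move=> m n mn; rewrite lee_fin; exact/lefP/nd_nnsfun_approx.
have mcvg (m : {measure set Y -> \bar R}) :
    \int[m]_y f y = limn (fun n => \int[m]_y (h n y)%:E).
  rewrite -monotone_convergence//.
  by apply: eq_integral => y _; apply/esym/cvg_lim => //; exact: cvg_nnsfun_approx.
rewrite mcvg; under eq_fun do rewrite nnsfunE.
under [RHS]eq_integral do rewrite mcvg.
rewrite monotone_convergence//.
- by move=> n; apply: measurable_funTS; exact: measurable_fun_integral_kernel.
- by move=> n x _; apply: integral_ge0.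
- by move=> x _ m n mn; apply: ge0_le_integral => //= y _; exact: ndh.
Qed.

End MeasureIntegrals.

Lemma integral_pushforward_mrestr d d' (T : measurableType d)
    (Y : measurableType d') (R : realType) (mu : {measure set T -> \bar R})
    (D : set T) (mD : measurable D) (X : {mfun T >-> Y}) (f : Y -> \bar R) :
  measurable_fun [set: Y] f -> (forall y, 0 <= f y)%E ->
  (\int[pushforward (mrestr mu mD) X]_y f y = \int[mu]_(x in D) f (X x))%E.
Proof.
move=> mf f0.
rewrite (@integral_mixture _ _ _ _ _ mu D (fun x => dirac (X x)))//.
- by apply: eq_integral => x _; rewrite integral_dirac// diracT mul1e.
- move=> B mB; apply/measurable_EFinP.
  by apply: measurableT_comp => //; exact: measurable_indic.
- move=> B mB; transitivity (\int[mu]_(x in D) (\1_(X @^-1` B) x)%:E)%E => //.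
  by rewrite integral_indic//; exact: measurable_funPTI.
Qed.

(** * Kernels that move with a density or stay put *)

Section HoldingKernel.
Context (R : realType) (g : R * R -> R).
Local Notation mu := (@lebesgue_measure R).
Hypotheses (mg : measurable_fun [set: R * R] g) (g0 : forall z, 0 <= g z).
Hypothesis g1 : forall x, (\int[mu]_y (g (x, y))%:E <= 1)%E.
Local Open Scope ereal_scope.

Let mgx x : measurable_fun [set: R] (fun y => (g (x, y))%:E).
Proof. exact/measurable_EFinP/measurableT_comp. Qed.

Let gx0 x y : 0 <= (g (x, y))%:E. Proof. by rewrite lee_fin. Qed.

Let move_part x (B : set R) := \int[mu]_(y in B) (g (x, y))%:E.

Let move_part0 x : move_part x set0 = 0.
Proof. exact: integral_set0. Qed.

Let move_part_ge0 x B : 0 <= move_part x B.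
Proof. exact: integral_ge0. Qed.

Let move_part_sigma_additive x : semi_sigma_additive (move_part x).
Proof.
exact (@semi_sigma_additive_nng_induced
  _ (measurableTypeR R) R mu _ (mgx x) (gx0 x)).
Qed.

HB.instance Definition _ x := isMeasure.Build _ R R (move_part x)
  (move_part0 x) (move_part_ge0 x) (@move_part_sigma_additive x).

Let move_fin x : move_part x setT \is a fin_num.
Proof. by rewrite ge0_fin_numE// (le_lt_trans (g1 x))// ltry. Qed.

Let stay_ge0 x : (0 <= 1 - fine (move_part x setT))%R.
Proof. by rewrite subr_ge0 -lee_fin fineK//; exact: g1. Qed.

Let K x : {measure set R -> \bar R} :=
  measure_add (move_part x) (mscale (NngNum (stay_ge0 x)) (dirac x)).

Let KE x B : K x B = move_part x B + (1 - move_part x setT) * \d_x B.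
Proof. by rewrite [LHS]measure_addE /= /mscale /= EFinB fineK. Qed.

Let mmove B : measurable B -> measurable_fun [set: R] (move_part ^~ B).
Proof.
move=> mB; pose gB (z : R * R) : \bar R := (g z)%:E * (\1_B z.2)%:E.
have -> : move_part ^~ B = fubini_F mu gB.
  apply/funext => x; rewrite /move_part /fubini_F /gB.
  by rewrite [LHS]integral_mkcond; apply: eq_integral => y _; rewrite epatch_indic.
apply: measurable_fun_fubini_tonelli_F => //.
- apply: emeasurable_funM; first exact/measurable_EFinP.
  by apply/measurable_EFinP; apply: measurableT_comp => //; exact: measurable_indic.
- by move=> z; apply: mule_ge0; rewrite lee_fin.
Qed.

Let mK B : measurable B -> measurable_fun [set: R] (K ^~ B).
Proof.
move=> mB; under eq_fun do rewrite KE.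
apply: emeasurable_funD; first exact: mmove.
apply: emeasurable_funM; last exact: measurable_fun_dirac.
by apply: emeasurable_funB => //; exact: mmove.
Qed.

HB.instance Definition _ := isKernel.Build _ _ R R R K mK.

Let K1 x : K x setT = 1.
Proof. by rewrite KE diracT mule1 addeC subeK. Qed.

HB.instance Definition _ := Kernel_isProbability.Build _ _ R R R K K1.

(** The shape shared by the Metropolis-Hastings kernel and its modification on
    a null set: move with subprobability density [g (x, _)], and stay at [x]
    with the remaining mass. *)
Lemma holding_kernel : exists K : R.-pker R ~> R, forall x B,
  K x B = \int[mu]_(y in B) (g (x, y))%:E
          + (1 - \int[mu]_y (g (x, y))%:E) * \d_x B.
Proof. by exists K => x B; rewrite -KE. Qed.

End HoldingKernel.

(** * Iterates of a kernel and the Doeblin minorization *)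

Section ProbabilityKernelComposition.
Context d0 d1 d2 (T0 : measurableType d0) (T1 : measurableType d1)
  (T2 : measurableType d2) (R : realType).
Variables (k1 : R.-pker T0 ~> T1) (k2 : R.-pker T1 ~> T2).

Let mkcomp_noparam_setT x : mkcomp_noparam k1 k2 x setT = 1%E.
Proof.
rewrite [LHS](_ : _ = (\int[k1 x]__ 1)%E); last first.
  by apply: eq_integral => y _; exact: prob_kernel.
by rewrite integral_cst// mul1e; exact: prob_kernel.
Qed.

HB.instance Definition _ := isProbabilityKernel.Build _ _ _ _ _
  (mkcomp_noparam k1 k2) mkcomp_noparam_setT.

End ProbabilityKernelComposition.

Section Doeblin.
Context d (T : measurableType d) (R : realType) (K : R.-pker T ~> T).
Local Open Scope ereal_scope.

Fixpoint kernel_iter (n : nat) : R.-pker T ~> T :=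
  if n is m.+1 then mkcomp_noparam K (kernel_iter m)
  else kdirac (@measurable_id _ T setT).

Variable pi : probability T R.
Hypothesis pi_invariant :
  forall B, measurable B -> pi B = \int[pi]_x K x B.

Lemma kernel_iter_invariant n B :
  measurable B -> pi B = \int[pi]_x kernel_iter n x B.
Proof.
move=> mB; elim: n => [|n IHn].
  by rewrite -[in LHS](setIT B) -(integral_indic pi measurableT mB).
rewrite IHn; apply: integral_mixture => //.
- by move=> C mC; exact: measurable_kernel.
- exact: measurable_kernel.
Qed.

(** Let [t] be the bound for [kernel_iter n] on [B].  The excess
    [h := kernel_iter n _ B - t] is nonnegative, so its integral against
    [K x] is at least [a] times its integral against [pi], and by invariance
    the latter is [pi B - t].  Hence the defect [pi B - t] shrinks by the
    factor [1 - a] at each step. *)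
Lemma doeblin_minorization (a : R) n x B : (0 <= a <= 1)%R ->
  (forall y C, measurable C -> a%:E * pi C <= K y C) ->
  measurable B -> (1 - (1 - a) ^+ n)%:E * pi B <= kernel_iter n x B.
Proof.
move=> /andP[a0 a1] minK mB; have pB := fin_num_measure pi B mB.
elim: n x => [|n IHn] x; first by rewrite expr0 subrr mul0e.
pose t := ((1 - (1 - a) ^+ n) * fine (pi B))%R.
have tE : t%:E = (1 - (1 - a) ^+ n)%:E * pi B by rewrite EFinM fineK.
have t0 : 0 <= t%:E.
  rewrite tE mule_ge0// lee_fin subr_ge0 exprn_ile1// ?subr_ge0//.
  by rewrite lerBlDr lerDl.
pose h y := kernel_iter n y B - t%:E.
have mh : measurable_fun setT h.
  by apply: emeasurable_funB => //; exact: measurable_kernel.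
have h0 y : 0 <= h y by rewrite /h sube_ge0// tE IHn.
have split_t (m : {measure set T -> \bar R}) : m setT = 1 ->
    \int[m]_y kernel_iter n y B = t%:E + \int[m]_y h y.
  move=> m1; have <- : \int[m]_y t%:E = t%:E by rewrite integral_cst// m1 mule1.
  rewrite -ge0_integralD//; apply: eq_integral => y _.
  by rewrite /h addeC subeK.
have := kernel_iter_invariant n mB.
rewrite (split_t pi (probability_setT pi)) => /esym piB.
rewrite [leRHS](split_t (K x) (prob_kernel x)).
have minh : a%:E * \int[pi]_y h y <= \int[K x]_y h y.
  by apply: (@le_scale_measure_integral _ _ _ (NngNum a0)) => // C mC; exact: minK.
apply: le_trans (leeD2l _ minh).
have -> : \int[pi]_y h y = pi B - t%:E by rewrite -piB [X in X - _]addeC addeK.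
rewrite -(fineK pB) -EFinB -!EFinM -EFinD lee_fin /t exprS.
by rewrite le_eqVlt; apply/orP; left; apply/eqP; ring.
Qed.

End Doeblin.

(** * Geometric ergodicity of Doeblin chains *)

Section SigmaOf.
Context d (T : measurableType d) (R : realType) (P : probability T R).
Variable X : int -> {RV P >-> R}.
Implicit Types (I J : set int) (A B : set T).

Lemma sigma_of_preimage I i (C : set R) :
  I i -> measurable C -> sigma_of X I (X i @^-1` C).
Proof.
move=> Ii mC; apply: sub_sigma_algebra; exists i => //=.
by exists C => //; rewrite setTI.
Qed.

Lemma sub_sigma_of I J : I `<=` J -> sigma_of X I `<=` sigma_of X J.
Proof.
move=> IJ; rewrite /sigma_of; apply: sub_sigma_algebra2 => A [i Ii XA].
by exists i => //; exact: IJ.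
Qed.

Lemma sigma_of_measurable I A : sigma_of X I A -> measurable A.
Proof.
move: A; apply: smallest_sub; first exact: sigma_algebra_measurable.
move=> _ [i _ [C mC <-]]; rewrite setTI.
exact: measurable_funPTI.
Qed.

Lemma sigma_ofT I : sigma_of X I setT.
Proof. exact: (@measurableT _ (g_sigma_algebraType _)). Qed.

Lemma sigma_ofI I A B : sigma_of X I A -> sigma_of X I B -> sigma_of X I (A `&` B).
Proof. exact: (@measurableI _ (g_sigma_algebraType _)). Qed.

Lemma sigma_ofC I A : sigma_of X I A -> sigma_of X I (~` A).
Proof. exact: (@measurableC _ (g_sigma_algebraType _)). Qed.

End SigmaOf.

Section DoeblinChain.
Context d (T : measurableType d) (R : realType) (P : probability T R).
Variables (X : int -> {RV P >-> R}) (K : R.-pker R ~> R).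
Local Notation past n := (sigma_of X [set i | i <= n]).
Local Notation pi := (distribution P (X 0)).

Hypothesis markov : forall (n : int) (A : set T) (B : set R),
  past n A -> measurable B ->
  P (A `&` X (n + 1) @^-1` B) = (\int[P]_(w in A) K (X n w) B)%E.

Local Open Scope ereal_scope.

Lemma markov_integral n A (phi : R -> \bar R) : past n A ->
  measurable_fun [set: R] phi -> (forall y, 0 <= phi y) ->
  \int[P]_(w in A) phi (X (n + 1)%R w) =
  \int[P]_(w in A) \int[K (X n w)]_y phi y.
Proof.
move=> nA mphi phi0; have mA := sigma_of_measurable nA.
rewrite -(integral_pushforward_mrestr _ mA)//.
apply: (@integral_mixture _ _ _ _ _ P A (fun w => K (X n w))) => //.
- by move=> B mB; exact: measurableT_comp (measurable_kernel K B mB) _.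
- by move=> B mB; rewrite -markov// /pushforward /mrestr setIC.
Qed.

(** The step from [n] to [n.+1] conditions at time [m + 1] first, which is why
    [m] and the past event vary in the induction. *)
Lemma markov_iter n m A B : past m A -> measurable B ->
  P (A `&` X (m + n%:Z)%R @^-1` B) =
  \int[P]_(w in A) kernel_iter K n (X m w) B.
Proof.
move=> + mB; elim: n m => [|n IHn] m mA.
  rewrite addr0 setIC.
  have mXB := measurable_funPTI (X m) mB.
  by rewrite -(integral_indic P (sigma_of_measurable mA) mXB).
rewrite [n.+1%:Z]intS addrA IHn; last first.
  by apply: sub_sigma_of mA => i /= /le_trans; apply; rewrite lerDl.
rewrite (markov_integral (phi := fun y => kernel_iter K n y B))//.
exact: measurable_kernel.
Qed.

Hypothesis stationary : forall n (B : set R), measurable B ->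
  distribution P (X n) B = pi B.

Lemma kernel_invariant B : measurable B -> pi B = \int[pi]_x K x B.
Proof.
move=> mB; have := @markov 0%R setT B (@sigma_ofT _ _ _ P X _) mB.
rewrite setTI add0r => PE; rewrite -(stationary 1%R)// [LHS]PE.
by rewrite ge0_integral_distribution//; exact: measurable_kernel.
Qed.

Variable a : R.
Hypotheses (a0 : (0 < a)%R) (a1 : (a < 1)%R).
Hypothesis minorization : forall x C, measurable C -> a%:E * pi C <= K x C.

Lemma kernel_iter_minorization n x B : measurable B ->
  (1 - (1 - a) ^+ n)%:E * pi B <= kernel_iter K n x B.
Proof.
move=> mB; apply: (@doeblin_minorization _ _ _ K pi kernel_invariant) => //.
by rewrite !ltW.
Qed.

(** The minorization of [B] bounds the deviation from below, and the
    minorization of the complement of [B] bounds it from above. *)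
Lemma doeblin_geometrically_ergodic : geometrically_ergodic X.
Proof.
exists (1 - a)%R, (cst 1%R); split => //.
- by rewrite subr_gt0 a1 gtrBl.
- by rewrite [_ \o _](_ : _ = cst 1%R)// expectation_cst ltry.
move=> n; exists (kernel_iter K n).
  move=> A B mA mB; rewrite -[n%:Z]add0r.
  rewrite markov_iter//; last exact: sigma_of_preimage.
  rewrite [RHS]ge0_integral_pushforward//.
  by apply: measurable_funTS; exact: measurable_kernel.
apply: aeW => x; apply: ge_ereal_sup => _ [B mB <-].
have Pn : P (X n%:Z @^-1` B) = pi B by exact: stationary.
rewrite Pn mulr1.
have r0 : (0 <= (1 - a) ^+ n)%R by rewrite exprn_ge0// subr_ge0 ltW.
pose p := fine (pi B); pose k := fine (kernel_iter K n x B).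
have pE : pi B = p%:E by rewrite fineK// fin_num_measure.
have kE : kernel_iter K n x B = k%:E by rewrite fineK// finite_kernel_measure.
have pC : pi (~` B) = (1 - p)%:E by rewrite probability_setC// EFinB -pE.
have kC : kernel_iter K n x (~` B) = (1 - k)%:E.
  have kT : kernel_iter K n x B + kernel_iter K n x (~` B) = 1.
    rewrite -measureU//; [|exact: measurableC|exact: setICr].
    by rewrite setUv; exact: prob_kernel.
  by rewrite EFinB -kT kE [X in X - _]addeC addeK.
have p0 : (0 <= p)%R by rewrite fine_ge0.
have p1 : (p <= 1)%R by rewrite -lee_fin -pE probability_le1.
have := kernel_iter_minorization n x (measurableC mB).
have := kernel_iter_minorization n x mB.
rewrite pE kE pC kC -EFinB -!EFinM !lee_fin.
move: r0; set r := ((1 - a) ^+ n)%R => r0 lo up.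
have rp0 := mulr_ge0 r0 p0.
have rp1 : (r * p <= r)%R by rewrite ler_piMr.
by rewrite ler_norml; apply/andP; split; lra.
Qed.

(** * The past and the future of a Doeblin chain *)

(** The conditional probability of [H] given the past up to time [n] has a
    version [phi (X n)].  Asking for values in [0, 1] everywhere, and not
    almost everywhere, keeps complements immediate. *)
Definition predicted_by_present (n : int) (H : set T) : Prop :=
  measurable H /\ exists phi : R -> R,
    [/\ measurable_fun [set: R] phi, forall x, (0 <= phi x <= 1)%R &
        forall A, past n A -> P (A `&` H) = \int[P]_(w in A) (phi (X n w))%:E].

Lemma predicted_by_presentT n : predicted_by_present n setT.
Proof.
split=> //; exists (cst 1%R); split => // [x|A nA]; first by rewrite ler01 lexx.
by rewrite setIT -[LHS]mul1e -integral_cst//; exact: sigma_of_measurable nA.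
Qed.

Lemma predicted_by_presentC n H :
  predicted_by_present n H -> predicted_by_present n (~` H).
Proof.
move=> [mH [phi [mphi phi01 phiE]]]; split; first exact: measurableC.
exists (fun x => 1 - phi x)%R; split.
- exact: measurable_funB.
- by move=> x; have := phi01 x; lra.
move=> A nA; have mA := sigma_of_measurable nA.
have mphiX : measurable_fun A (fun w => (phi (X n w))%:E).
  by apply/measurable_EFinP; apply: measurable_funTS; exact: measurableT_comp.
have mphiXC : measurable_fun A (fun w => (1 - phi (X n w))%:E).
  by apply/measurable_EFinP; apply: measurable_funB => //; exact/measurable_EFinP.
have : P (A `&` H) + P (A `&` ~` H) =
    P (A `&` H) + \int[P]_(w in A) (1 - phi (X n w))%:E.
  transitivity (P A).
    rewrite -measureU//.
    - by rewrite -setIUr setUv setIT.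
    - exact: measurableI.
    - by apply: measurableI => //; exact: measurableC.
    - by rewrite setIACA setICr setI0.
  rewrite phiE// -ge0_integralD//; last 2 first.
  - by move=> w _; rewrite lee_fin; have /andP[] := phi01 (X n w).
  - by move=> w _; rewrite lee_fin subr_ge0; have /andP[] := phi01 (X n w).
  transitivity (\int[P]_(w in A) 1); first by rewrite integral_cst// mul1e.
  by apply: eq_integral => w _; rewrite -EFinD addrC subrK.
have fAH : P (A `&` H) \is a fin_num.
  by rewrite fin_num_measure//; exact: measurableI.
move=> /(congr1 (fun z => z - P (A `&` H))).
by rewrite [X in X - _]addeC addeK// [X in X - _]addeC addeK.
Qed.

(** The sum [S] of the predictors is the natural candidate, but it may exceed
    [1] on a null set, so it is truncated to [mine S 1].  That the truncation
    loses nothing is seen by splitting a past event along [S (X n) <= 1]: where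
    it fails the truncation equals [1], which is at least the conditional
    probability anyway. *)
Lemma predicted_by_present_bigcup n (H : (set T)^nat) : trivIset setT H ->
  (forall k, predicted_by_present n (H k)) ->
  predicted_by_present n (\bigcup_k H k).
Proof.
move=> tH pH; have mH k : measurable (H k) by case: (pH k).
split; first exact: bigcupT_measurable.
have /choice[phi phiP] : forall k, exists phi : R -> R,
    [/\ measurable_fun [set: R] phi, forall x, (0 <= phi x <= 1)%R &
        forall A, past n A -> P (A `&` H k) = \int[P]_(w in A) (phi (X n w))%:E].
  by move=> k; case: (pH k).
have mphi k : measurable_fun [set: R] (fun x => (phi k x)%:E).
  by apply/measurable_EFinP; case: (phiP k).
have phi0 k x : 0 <= (phi k x)%:E.
  by rewrite lee_fin; case: (phiP k) => _ /(_ x)/andP[].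
pose S x := \sum_(k <oo) (phi k x)%:E.
have mS : measurable_fun [set: R] S by exact: ge0_emeasurable_sum.
have S0 x : 0 <= S x by exact: nneseries_ge0.
have intS A : past n A ->
    P (A `&` \bigcup_k H k) = \int[P]_(w in A) S (X n w).
  move=> nA; have mA := sigma_of_measurable nA.
  rewrite setI_bigcupr measure_bigcup//; last 2 first.
  - by move=> k _; exact: measurableI.
  - exact: trivIset_setIl.
  rewrite integral_nneseries//; last first.
    by move=> k; apply: measurable_funTS; exact: measurableT_comp (mphi k) _.
  rewrite (@eq_eseriesl _ _ xpredT); last by move=> k; rewrite in_setT.
  by apply: eq_eseriesr => k _; have [_ _ phiE] := phiP k; exact: phiE.
pose psi x := fine (mine (S x) 1).
have psiE x : (psi x)%:E = mine (S x) 1.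
  rewrite fineK// ge0_fin_numE ?le_min ?S0 ?lee01//.
  by rewrite gt_min ltry orbT.
have mmin : measurable_fun [set: R] (fun x => mine (S x) 1).
  exact: measurable_mine.
exists psi; split.
- apply/measurable_EFinP.
  rewrite [X in measurable_fun _ X](_ : _ = fun x => mine (S x) 1)//.
  by apply/funext => x; exact: psiE.
- by move=> x; rewrite -!lee_fin psiE le_min S0 lee01 ge_min lexx orbT.
move=> A nA; have mA := sigma_of_measurable nA.
under eq_integral do rewrite psiE.
have mminX D : measurable_fun D (fun w => mine (S (X n w)) 1).
  by apply: measurable_funTS; exact: measurableT_comp mmin _.
have min0 w : 0 <= mine (S (X n w)) 1 by rewrite le_min S0 lee01.
(* Truncating can only decrease the integral; the other inequality is split
   along [D]. *)
apply/eqP; rewrite eq_le; apply/andP; split; last first.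
  rewrite intS//; apply: ge0_le_integral => //.
  - by apply: measurable_funTS; exact: measurableT_comp mS _.
  - by move=> w _; rewrite ge_min lexx.
pose D := X n @^-1` [set x | S x <= 1].
have nD : past n D.
  apply: sigma_of_preimage => /=; first exact: lexx.
  by rewrite -[X in measurable X]setTI; exact: emeasurable_fun_le.
have mD := sigma_of_measurable nD.
have nAD := sigma_ofI nA nD; have mAD := sigma_of_measurable nAD.
have nAC : past n (A `&` ~` D) by apply: sigma_ofI => //; exact: sigma_ofC.
have mAC := sigma_of_measurable nAC.
have AE : A = (A `&` D) `|` (A `&` ~` D) by rewrite -setIUr setUv setIT.
have ADC : (A `&` D) `&` (A `&` ~` D) = set0 by rewrite setIACA setICr setI0.
rewrite [X in P (X `&` _)]AE [X in \int[P]_(_ in X) _]AE.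
rewrite ge0_integral_setU//; last exact/disj_set2P.
have mU : measurable (\bigcup_k H k) by exact: bigcupT_measurable.
have mADU := measurableI _ _ mAD mU; have mACU := measurableI _ _ mAC mU.
rewrite setIUl; apply: (le_trans (measureU2 _ mADU mACU)); apply: leeD.
  rewrite [leLHS](intS _ nAD) le_eqVlt; apply/orP; left; apply/eqP.
  by apply: eq_integral => w /set_mem[_ wD]; rewrite min_l.
rewrite (@le_trans _ _ (P (A `&` ~` D)))//.
  by rewrite le_measure ?inE//; exact: measurableI.
rewrite -[leLHS]mul1e -integral_cst// le_eqVlt; apply/orP; left; apply/eqP.
apply: eq_integral => w /set_mem[_ /negP]; rewrite -ltNge => wD.
by rewrite min_r// ltW.
Qed.

(** Conditioning on the past up to time [n + 1] replaces [H] by a function of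
    [X (n + 1)], and conditioning on the past up to time [n] then averages this
    function with the kernel. *)
Lemma predicted_by_present_step n (B : set R) H : measurable B ->
  predicted_by_present (n + 1) H -> predicted_by_present n (X n @^-1` B `&` H).
Proof.
move=> mB [mH [phi [mphi phi01 phiE]]].
split; first by apply: measurableI => //; exact: measurable_funPTI.
have mEphi : measurable_fun [set: R] (fun x => (phi x)%:E) by exact/measurable_EFinP.
have Ephi0 x : 0 <= (phi x)%:E by rewrite lee_fin; have /andP[] := phi01 x.
pose Kphi x := \int[K x]_y (phi y)%:E.
have Kphi0 x : 0 <= Kphi x by exact: integral_ge0.
have Kphi1 x : Kphi x <= 1.
  apply: (@le_trans _ _ (\int[K x]__ 1)); last first.
    by rewrite integral_cst// mul1e prob_kernel.
  by apply: ge0_le_integral => // y _; rewrite lee_fin; have /andP[] := phi01 y.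
have mKphi : measurable_fun [set: R] Kphi.
  by apply: measurable_fun_integral_kernel => // C mC; exact: measurable_kernel.
have KphiE x : (fine (Kphi x))%:E = Kphi x.
  by rewrite fineK// ge0_fin_numE// (le_lt_trans (Kphi1 x))// ltry.
exists (fun x => fine (Kphi x) * \1_B x)%R; split.
- apply: measurable_funM => //.
  by apply/measurable_EFinP; rewrite (_ : EFin \o _ = Kphi)//; exact/funext.
- move=> x; have K0 := Kphi0 x; have K1 := Kphi1 x.
  move: K0 K1; rewrite -KphiE !lee_fin indicE => K0 K1.
  by case: (x \in B); rewrite ?mulr1 ?mulr0 ?K0 ?K1 ?lexx ?ler01.
move=> A nA; have mA := sigma_of_measurable nA.
have nXB : past n (X n @^-1` B) by apply: sigma_of_preimage => //=; exact: lexx.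
rewrite setIA phiE; last first.
  by apply: sub_sigma_of (sigma_ofI nA nXB) => i /= /le_trans; apply; rewrite lerDl.
rewrite (markov_integral (phi := fun x => (phi x)%:E))//; last exact: sigma_ofI.
rewrite integral_mkcondr; apply: eq_integral => w _.
by rewrite epatch_indic EFinM KphiE.
Qed.

(** Cylinders are written as infinite intersections with almost all factors
    trivial, so that they are closed under intersection factor by factor. *)
Lemma cylinder_predicted_by_present m n (B : nat -> set R) :
  (forall j, measurable (B j)) -> (forall j, (m <= j)%N -> B j = setT) ->
  predicted_by_present n (\bigcap_j (X (n + j%:Z)%R @^-1` B j)).
Proof.
elim: m n B => [|m IHm] n B mB BT.
  rewrite (_ : \bigcap_j _ = setT); first exact: predicted_by_presentT.
  by rewrite -subTset => w _ j _; rewrite BT.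
rewrite (_ : \bigcap_j _ = X n @^-1` B 0%N `&`
    \bigcap_j (X (n + 1 + j%:Z)%R @^-1` B j.+1)).
  apply: predicted_by_present_step => //; apply: IHm => j.
    exact: mB.
  by move=> mj; exact: BT.
rewrite eqEsubset; split=> [w Bw|w [B0w BSw] [|j] _].
- split; first by have := Bw 0%N I; rewrite /= addr0.
  by move=> j _; have := Bw j.+1 I; rewrite /= intS addrA.
- by rewrite /= addr0.
- by have := BSw j I; rewrite /= intS addrA.
Qed.

Lemma future_predicted_by_present n :
  sigma_of X [set i | n <= i]%R `<=` predicted_by_present n.
Proof.
pose cylinder (H : set T) := exists (m : nat) (B : nat -> set R),
  [/\ forall j, measurable (B j), forall j, (m <= j)%N -> B j = setT &
      H = \bigcap_j (X (n + j%:Z)%R @^-1` B j)].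
have cylinderI : setI_closed cylinder.
  move=> _ _ [m1 [B1 [mB1 B1T ->]]] [m2 [B2 [mB2 B2T ->]]].
  exists (maxn m1 m2), (fun j => B1 j `&` B2 j); split.
  - by move=> j; exact: measurableI.
  - by move=> j; rewrite geq_max => /andP[? ?]; rewrite B1T// B2T// setIT.
  - by rewrite -bigcapI; apply: eq_bigcapr.
have future_cylinder : sigma_of X [set i | n <= i]%R `<=` <<s cylinder >>.
  rewrite /sigma_of; apply: smallest_sub; first exact: smallest_sigma_algebra.
  move=> _ [i /= ni [C mC <-]]; apply: sub_sigma_algebra.
  have [j ij] : exists j : nat, i = (n + j%:Z)%R.
    by exists `|i - n|%N; rewrite gez0_abs ?subr_ge0// [RHS]addrC subrK.
  exists j.+1, (fun k => if k == j then C else setT); split.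
  - by move=> k; case: ifP.
  - by move=> k jk; rewrite gtn_eqF.
  - rewrite setTI eqEsubset ij; split=> [w Cw k _ /=|w /(_ j I) /=].
      by case: eqVneq => [->|//].
    by rewrite eqxx.
apply: (subset_trans future_cylinder).
rewrite -setI_closed_g_dynkin_g_sigma_algebra//; apply: smallest_sub.
  split.
  - exact: predicted_by_presentT.
  - by move=> H; exact: predicted_by_presentC.
  - by move=> H; exact: predicted_by_present_bigcup.
by move=> _ [m [B [mB BT ->]]]; exact: cylinder_predicted_by_present BT.
Qed.

(** Restricting the law of [X n] to the past event [A] gives a measure that
    dominates [(1 - (1 - a) ^+ n) * P A * pi]; it remains to integrate the
    predictor of [H] against both. *)
Lemma past_future_lower_bound n A H :
  past 0%R A -> sigma_of X [set i | n%:Z <= i]%R H ->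
  (1 - (1 - a) ^+ n)%:E * (P A * P H) <= P (A `&` H).
Proof.
move=> nA /future_predicted_by_present[mH [phi [mphi phi01 phiE]]].
have mA := sigma_of_measurable nA.
have mEphi : measurable_fun [set: R] (fun x => (phi x)%:E) by exact/measurable_EFinP.
have Ephi0 x : 0 <= (phi x)%:E by rewrite lee_fin; have /andP[] := phi01 x.
have c0 : (0 <= (1 - (1 - a) ^+ n) * fine (P A))%R.
  rewrite mulr_ge0 ?fine_ge0// subr_ge0 exprn_ile1 ?subr_ge0 ?ltW//.
  by rewrite gtrBl.
rewrite phiE; last by apply: sub_sigma_of nA => i /= /le_trans; apply.
rewrite -(integral_pushforward_mrestr P mA (X n%:Z) (f := fun x => (phi x)%:E))//.
have -> : P H = \int[pi]_x (phi x)%:E.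
  rewrite (@eq_measure_integral _ _ _ _ (distribution P (X n%:Z))); last first.
    by move=> B mB _; exact/esym/stationary.
  rewrite ge0_integral_distribution// -[in LHS](setTI H).
  by rewrite [LHS]phiE//; exact: sigma_ofT.
rewrite muleA -[in leLHS](fineK (fin_num_measure P A mA)) -EFinM.
apply: (@le_scale_measure_integral _ _ _ (NngNum c0)) => // B mB /=.
rewrite /pushforward /mrestr EFinM fineK ?fin_num_measure// setIC.
rewrite -[n%:Z]add0r markov_iter//.
have -> : (1 - (1 - a) ^+ n)%:E * P A * pi B =
    \int[P]_(_ in A) ((1 - (1 - a) ^+ n)%:E * pi B).
  by rewrite integral_cst// muleAC.
apply: ge0_le_integral => //.
- move=> w _; rewrite mule_ge0// lee_fin subr_ge0 exprn_ile1 ?subr_ge0 ?ltW//.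
  by rewrite gtrBl.
- by apply: measurable_funTS; exact: measurableT_comp (measurable_kernel _ B mB) _.
- by move=> w _; exact: kernel_iter_minorization.
Qed.

End DoeblinChain.

(** * Maximal correlation from a lower bound on joint probabilities *)

Section RhoBound.
Import HBSimple HBNNSimple.
Context d (T : measurableType d) (R : realType) (P : probability T R).

(** Composed with a random variable [v], these approximations of the identity
    give simple functions that are dominated by [v] and whose level sets are
    preimages under [v], hence lie in the sigma-algebra of [v]. *)
Lemma sfun_approximation_id : exists h : {sfun R >-> R}^nat,
  (forall k x, `|h k x| <= `|x|) /\ (forall x, h k x @[k --> \oo] --> x).
Proof.
pose id_ereal (x : R) : \bar R := x%:E.
have mid : measurable_fun [set: R] id_ereal by exact/measurable_EFinP.
pose p := nnsfun_approx measurableT (measurable_funepos mid).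
pose n := nnsfun_approx measurableT (measurable_funeneg mid).
have p_le k x : p k x <= Num.max x 0.
  rewrite -lee_fin nnsfun_approxE; apply: le_trans (le_approx _ _ _) _ => //.
  by rewrite funeposE EFin_max.
have n_le k x : n k x <= Num.max (- x) 0.
  rewrite -lee_fin nnsfun_approxE; apply: le_trans (le_approx _ _ _) _ => //.
  by rewrite funenegE EFin_max.
exists (fun k => (p k : {sfun R >-> R}) - (n k : {sfun R >-> R})); split => [k x|x].
  rewrite (_ : _ x = p k x - n k x)//.
  have pk0 : 0 <= p k x by []. have nk0 : 0 <= n k x by [].
  have := p_le k x; have := n_le k x; have x0 := normr_ge0 x.
  have x1 := ler_norm x; have x2 : - x <= `|x| by rewrite -normrN ler_norm.
  rewrite !le_max ler_norml => /orP[?|?] /orP[?|?]; apply/andP; split; lra.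
rewrite (_ : (fun k => _) = (fun k => p k x - n k x))//.
rewrite [X in _ --> X](_ : _ = Num.max x 0 - Num.max (- x) 0); last first.
  have [x0|x0] := leP 0 x.
    by rewrite [X in _ - X]max_r ?oppr_le0// subr0.
  by rewrite [X in _ - X]max_l ?oppr_ge0 ?ltW// sub0r opprK.
apply: cvgB.
  have : EFin \o p ^~ x @ \oo --> (Num.max x 0)%:E.
    rewrite EFin_max -[maxe _ _](funeposE id_ereal x).
    by apply: cvg_nnsfun_approx.
  by move=> /fine_cvg.
have : EFin \o n ^~ x @ \oo --> (Num.max (- x) 0)%:E.
  rewrite EFin_max -[maxe _ _](funenegE id_ereal x).
  by apply: cvg_nnsfun_approx.
by move=> /fine_cvg.
Qed.

Variables (G H : set (set T)) (eps : R).
Hypotheses (eps01 : 0 <= eps <= 1).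
Hypothesis lower_bound : forall A B, G A -> H B ->
  ((1 - eps)%:E * (P A * P B) <= P (A `&` B))%E.

Section Centered.
Variables (u v : {mfun T >-> R}).
Hypotheses (uG : forall C : set R, measurable C -> G (u @^-1` C))
  (vH : forall C : set R, measurable C -> H (v @^-1` C)).
Hypotheses (u2 : (u : T -> R) \in Lfun P 2%:E) (v2 : (v : T -> R) \in Lfun P 2%:E).
Hypothesis u0 : \int[P]_w u w = 0.

Let iu : P.-integrable setT (EFin \o u).
Proof. by apply/Lfun1_integrable/Lfun_subset12 => //; exact: fin_num_measure. Qed.

Let iuu : P.-integrable setT (EFin \o (fun w => u w ^+ 2)).
Proof. exact: Lfun2_integrable_sqr. Qed.

Let ivv : P.-integrable setT (EFin \o (fun w => v w ^+ 2)).
Proof. exact: Lfun2_integrable_sqr. Qed.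

Let iuv : P.-integrable setT (EFin \o (fun w => u w * v w)).
Proof. exact/Lfun1_integrable/Lfun2_mul_Lfun1. Qed.

Let icst (c : R) : P.-integrable setT (EFin \o (fun=> c)).
Proof. exact: finite_measure_integrable_cst. Qed.

Let RE (f : T -> R) : P.-integrable setT (EFin \o f) ->
  (\int[P]_w (f w)%:E = (\int[P]_w f w)%:E)%E.
Proof. by move=> fi; rewrite /Rintegral fineK//; exact: integrable_fin_num. Qed.

Let iD (f g : T -> R) : P.-integrable setT (EFin \o f) ->
  P.-integrable setT (EFin \o g) ->
  P.-integrable setT (EFin \o (fun w => f w + g w)).
Proof.
by move=> fi gi; exact: (@integrableD _ _ _ P setT measurableT _ _ fi gi).
Qed.

Let iZ (c : R) (f : T -> R) : P.-integrable setT (EFin \o f) ->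
  P.-integrable setT (EFin \o (fun w => c * f w)).
Proof. by move=> fi; exact: (@integrableZl _ _ _ P setT measurableT c _ fi). Qed.

Let Rcst (c : R) : \int[P]_w c = c.
Proof. by rewrite Rintegral_cst// [X in fine X](probability_setT P) mulr1. Qed.

(** For a fixed event [B] the lower bound compares two laws of [u], and
    measures that compare on sets compare on nonnegative functions. *)
Lemma event_integral_lower_bound (B : set T) (phi : R -> \bar R) :
  measurable B -> H B -> measurable_fun [set: R] phi -> (forall x, 0 <= phi x)%E ->
  ((1 - eps)%:E * P B * \int[P]_w phi (u w) <= \int[P]_(w in B) phi (u w))%E.
Proof.
move=> mB HB mphi phi0.
have c0 : 0 <= (1 - eps) * fine (P B).
  by rewrite mulr_ge0 ?fine_ge0// subr_ge0; case/andP: eps01.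
have pB : (P B = (fine (P B))%:E)%E by rewrite fineK// fin_num_measure.
rewrite -(integral_pushforward_mrestr P mB u)//.
rewrite -(ge0_integral_distribution (P := P) u)// [in leLHS]pB -EFinM.
apply: (@le_scale_measure_integral _ _ _ (NngNum c0)) => // C mC.
rewrite /= EFinM -pB /distribution /pushforward /mrestr -muleA (muleC (P B)).
by apply: lower_bound => //; exact: uG.
Qed.

(** On each level set of [h \o v] the second factor is a constant [b], and
    the lower bound applies to the nonnegative function [(u - b) ^+ 2].
    Summing over the levels compares the mean of [(u - h v) ^+ 2] with
    [1 - eps] times its mean under independence; the latter has no cross term
    because [u] is centered, so the cross term of the former is controlled. *)
Lemma simple_product_bound (h : {sfun R >-> R}) :
  2 * \int[P]_w (u w * h (v w)) <=
  eps * (\int[P]_w u w ^+ 2 + \int[P]_w h (v w) ^+ 2).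
Proof.
have /finite_seqP[s0 range_h] := fimfunP h; pose s := undup s0.
have hs x : h x \in s.
  rewrite mem_undup; have : range h (h x) by exists x.
  by rewrite range_h.
pose F b := v @^-1` (h @^-1` [set b]).
have mF b : measurable (F b).
  by apply: measurable_funPTI => //; exact: measurable_funPTI.
have HF b : H (F b) by apply: vH; exact: measurable_funPTI.
have us : uniq s by exact: undup_uniq.
have tF : trivIset [set` s] F.
  by move=> b c _ _ [w [/= <- <-]].
have coverF : \big[setU/set0]_(b <- s) F b = setT.
  rewrite -subTset => w _; rewrite -bigcup_seq.
  by exists (h (v w)) => //=; exact: hs.
pose hv w := h (v w).
have mhv : measurable_fun [set: T] hv by exact: measurableT_comp.
have [M hM] : exists M : R, forall x, `|h x| <= M.
  have [M [_ hM]] := simple_bounded h.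
  by exists (M + 1) => x; apply: (hM (M + 1)) => //; rewrite ltrDl.
have ihv2 : P.-integrable setT (EFin \o (fun w => hv w ^+ 2)).
  apply: (@le_integrable _ _ _ P setT _ _ (EFin \o cst (M ^+ 2))) => //.
  - by apply/measurable_EFinP; exact: measurable_funX.
  - move=> w _ /=; rewrite lee_fin !normrX lerXn2r ?nnegrE//.
    by rewrite (le_trans (hM _))// ler_norm.
  - exact: finite_measure_integrable_cst.
have iuhv : P.-integrable setT (EFin \o (fun w => u w * hv w)).
  apply: (@le_integrable _ _ _ P setT _ _ (EFin \o (fun w => M * u w))) => //.
  - by apply/measurable_EFinP; exact: measurable_funM.
  - move=> w _ /=; rewrite lee_fin !normrM mulrC ler_wpM2r//.
    by rewrite (le_trans (hM _))// ler_norm.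
  - exact: iZ.
have sq_expand (f : T -> R) : P.-integrable setT (EFin \o (fun w => f w ^+ 2)) ->
    P.-integrable setT (EFin \o (fun w => u w * f w)) ->
    (\int[P]_w ((u w - f w) ^+ 2)%:E = (\int[P]_w u w ^+ 2
      - 2 * \int[P]_w (u w * f w) + \int[P]_w f w ^+ 2)%:E)%E.
  move=> if2 iuf; pose g w := u w ^+ 2 + - 2 * (u w * f w) + f w ^+ 2.
  have iuuf := iD iuu (iZ (- 2) iuf).
  transitivity (\int[P]_w (g w)%:E)%E.
    by apply: eq_integral => w _; congr EFin; rewrite /g; ring.
  rewrite RE; last exact: iD iuuf if2.
  rewrite RintegralD; [|by []|exact: iuuf|exact: if2].
  rewrite RintegralD; [|by []|exact: iuu|exact: iZ].
  by rewrite RintegralZl// mulNr.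
have split_F (f : T -> R) : measurable_fun [set: T] f -> (forall w, 0 <= f w) ->
    (\int[P]_w (f w)%:E = \sum_(b <- s) \int[P]_(w in F b) (f w)%:E)%E.
  move=> mf f0; rewrite -[X in (\int[P]_(_ in X) _)%E]coverF ge0_integral_bigsetU//.
    by rewrite coverF; exact/measurable_EFinP.
  by move=> w _; rewrite lee_fin.
set S := \int[P]_w u w ^+ 2 in sq_expand *.
set V := \int[P]_w h (v w) ^+ 2.
have S0 : 0 <= S by apply: Rintegral_ge0 => w _; exact: sqr_ge0.
have key : ((1 - eps)%:E * \int[P]_w (S + hv w ^+ 2)%:E
    <= \int[P]_w ((u w - hv w) ^+ 2)%:E)%E.
  rewrite [leRHS]split_F; last 2 first.
  - by apply: measurable_funX; exact: measurable_funB.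
  - by move=> w; exact: sqr_ge0.
  rewrite split_F; last 2 first.
  - by apply: measurable_funD => //; exact: measurable_funX.
  - by move=> w; rewrite addr_ge0// sqr_ge0.
  rewrite ge0_sume_distrr; last first.
    by move=> b _; apply: integral_ge0 => w _; rewrite lee_fin addr_ge0// sqr_ge0.
  apply: lee_sum => b _.
  have FbE w : w \in F b -> hv w = b by move/set_mem.
  rewrite (eq_integral (cst (S + b ^+ 2)%:E)); last by move=> w /FbE ->.
  rewrite [leRHS](eq_integral (fun w => ((u w - b) ^+ 2)%:E)); last first.
    by move=> w /FbE ->.
  have := @event_integral_lower_bound _ (fun x => ((x - b) ^+ 2)%:E) (mF b) (HF b).
  rewrite (sq_expand (cst b)); last 2 first.
  - exact: icst (b ^+ 2).
  - under eq_fun do rewrite mulrC.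
    exact: iZ.
  rewrite /= RintegralZr// u0 mul0r mulr0 subr0 Rcst.
  rewrite integral_cst// -muleA (muleC (P _)); apply.
  - by apply/measurable_EFinP; apply: measurable_funX; exact: measurable_funB.
  - by move=> x; rewrite lee_fin sqr_ge0.
move: key; rewrite sq_expand// RE; last exact: iD (icst S) ihv2.
rewrite -EFinM lee_fin RintegralD; [|by []|exact: icst|exact: ihv2].
rewrite Rcst -/V.
by case/andP: eps01; lra.
Qed.

(** Dominated convergence is needed for the mixed term only: the simple
    approximations of [v] are dominated by [v], so that their second moments
    are bounded by that of [v]. *)
Lemma centered_product_bound :
  2 * \int[P]_w (u w * v w) <=
  eps * (\int[P]_w u w ^+ 2 + \int[P]_w v w ^+ 2).
Proof.
have [h [h_le h_cvg]] := sfun_approximation_id.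
set c := eps * _.
have hv2 k : \int[P]_w h k (v w) ^+ 2 <= \int[P]_w v w ^+ 2.
  apply: le_Rintegral => //.
  - apply: (@le_integrable _ _ _ P setT measurableT _
      (EFin \o (fun w => v w ^+ 2))) => //.
    + apply/measurable_EFinP; apply: measurable_funX; exact: measurableT_comp.
    + by move=> w _ /=; rewrite lee_fin !normrX lerXn2r ?nnegrE.
  - move=> w _; rewrite -[leLHS]ger0_norm ?sqr_ge0//.
    by rewrite -[leRHS]ger0_norm ?sqr_ge0// !normrX lerXn2r ?nnegrE.
have muhv k : measurable_fun [set: T] (fun w => u w * h k (v w)).
  by apply: measurable_funM => //; exact: measurableT_comp.
have uhv_le k w : `|u w * h k (v w)| <= `|u w * v w|.
  by rewrite !normrM ler_wpM2l.
have iuhv k : P.-integrable setT (EFin \o (fun w => u w * h k (v w))).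
  apply: (@le_integrable _ _ _ P setT measurableT _
    (EFin \o (fun w => u w * v w))) => //.
  - exact/measurable_EFinP.
  - by move=> w _; exact: uhv_le.
have le_c k : (\int[P]_w (u w * h k (v w))%:E <= (c / 2)%:E)%E.
  rewrite RE// lee_fin ler_pdivlMr// mulrC.
  apply: le_trans (simple_product_bound (h k)) _.
  by rewrite /c ler_wpM2l ?lerD2l//; case/andP: eps01.
have dominated := @dominated_convergence _ _ _ P setT measurableT
  (fun k w => (u w * h k (v w))%:E) (fun w => (u w * v w)%:E)
  (fun w => `|(u w * v w)%:E|%E).
have [] := dominated.
- by move=> k; exact/measurable_EFinP.
- by apply/measurable_EFinP; exact: measurable_funM.
- apply: aeW => w _; apply: cvg_EFin; first exact: nearW.
  by apply: cvgMr; exact: h_cvg.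
- exact: integrable_abse.
- by apply: aeW => w k _; exact: uhv_le.
move=> _ _ cvg_uv.
have : (\int[P]_w (u w * v w)%:E <= (c / 2)%:E)%E.
  rewrite -(cvg_lim _ cvg_uv)//; apply: lime_le; last exact: nearW.
  by apply/cvg_ex; exists (\int[P]_w (u w * v w)%:E)%E.
by rewrite RE// lee_fin ler_pdivlMr// mulrC.
Qed.

End Centered.

Lemma standardized (g : T -> R) : g \in Lfun P 2%:E -> 0 < fine 'V_P[g] ->
  exists u : {mfun T >-> R},
    [/\ u =1 (fun w => (g w - fine 'E_P[g]) / Num.sqrt (fine 'V_P[g])),
        (u : T -> R) \in Lfun P 2%:E,
        \int[P]_w u w = 0 & \int[P]_w u w ^+ 2 = 1].
Proof.
move=> g2 Vg0; set s := Num.sqrt _; set m := fine _.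
have s0 : 0 < s by rewrite sqrtr_gt0.
pose gm := g \- cst m; pose u0 := s^-1 \o* gm.
have m2 : (cst m : T -> R) \in Lfun P 2%:E by exact: Lfun_cst.
have gm2 : gm \in Lfun P 2%:E by rewrite rpredB// lee1n.
have u2 : u0 \in Lfun P 2%:E by rewrite Lfun_scale// ler1n.
have mu : u0 \in mfun by case/andP: u2.
have PT : P setT \is a fin_num by exact: fin_num_measure.
have ig := (Lfun1_integrable P g).1 (Lfun_subset12 PT g2).
have igm := (Lfun1_integrable P gm).1 (Lfun_subset12 PT gm2).
have gm0 : \int[P]_w gm w = 0.
  rewrite /gm RintegralB//; last exact: finite_measure_integrable_cst.
  rewrite Rintegral_cst// [X in fine X](probability_setT P) mulr1.
  by rewrite /m unlock subrr.
have VE : \int[P]_w gm w ^+ 2 = fine 'V_P[g].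
  rewrite /variance covariance.unlock -/m expectation.unlock.
  by congr fine; apply: eq_integral => w _; rewrite /= expr2.
exists (mfun_Sub mu); split => //=.
  by rewrite /u0 /= RintegralZr// gm0 mul0r.
transitivity (\int[P]_w (gm w ^+ 2 * s^-1 ^+ 2)).
  by apply: eq_Rintegral => w _; rewrite /u0 /= exprMn.
rewrite RintegralZr//; last exact: Lfun2_integrable_sqr.
by rewrite VE exprVn sqr_sqrtr ?ltW// divff// gt_eqF.
Qed.

(** For the standardizations [u] and [v] of [g] and [h] the mean of [u * v] is
    the correlation, and both second moments in the product bound are [1]. *)
Lemma rho_le_of_lower_bound : (rho P G H <= eps%:E)%E.
Proof.
apply: ge_ereal_sup => _ [g [gG g2] [h [hH h2] <-]].
rewrite lee_fin /correlation.
have Vge0 (k : T -> R) : 0 <= fine 'V_P[k] by rewrite fine_ge0// variance_ge0.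
have eps0 : 0 <= eps by case/andP: eps01.
have := Vge0 g; rewrite le_eqVlt => /orP[/eqP<-|Vg].
  by rewrite sqrtr0 mul0r invr0 mulr0.
have := Vge0 h; rewrite le_eqVlt => /orP[/eqP<-|Vh].
  by rewrite sqrtr0 mulr0 invr0 mulr0.
have [u [uE u2 u0 uu1]] := standardized g2 Vg.
have [v [vE v2 _ vv1]] := standardized h2 Vh.
have affine_preimage (k w : T -> R) (m r : R) (F : set (set T)) (C : set R) :
    w =1 (fun t => (k t - m) / r) -> preimage_set_system setT k measurable `<=` F ->
    measurable C -> F (w @^-1` C).
  move=> wE kF mC; apply: kF; exists ((fun x => (x - m) / r) @^-1` C).
    have maff : measurable_fun [set: R] (fun x : R => (x - m) / r).
      by apply: measurable_funM => //; exact: measurable_funB.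
    by rewrite -[X in measurable X]setTI; exact: maff.
  by rewrite setTI; apply/seteqP; split => t /=; rewrite wE.
have uG C : measurable C -> G (u @^-1` C) by exact: affine_preimage uE gG.
have vH C : measurable C -> H (v @^-1` C) by exact: affine_preimage vE hH.
have := centered_product_bound uG vH u2 v2 u0; rewrite uu1 vv1.
set c := _ / _; suff -> : \int[P]_w (u w * v w) = c by lra.
set sg := Num.sqrt (fine 'V_P[g]); set sh := Num.sqrt (fine 'V_P[h]).
have sgsh0 : sg * sh != 0 by rewrite mulf_neq0// gt_eqF// sqrtr_gt0.
apply: (mulIf sgsh0); rewrite /c divfK// -RintegralZr//; last first.
  exact/Lfun1_integrable/Lfun2_mul_Lfun1.
set mg := fine 'E_P[g] in uE; set mh := fine 'E_P[h] in vE.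
rewrite covariance.unlock -/mg -/mh expectation.unlock; congr fine.
apply: eq_integral => w _; rewrite uE vE /=; congr EFin.
have : sg != 0 by rewrite gt_eqF// sqrtr_gt0.
have : sh != 0 by rewrite gt_eqF// sqrtr_gt0.
rewrite -/sg -/sh => sh0 sg0.
rewrite [RHS](_ : _ = (g w - mg) * (h w - mh))//.
by field; rewrite sh0 sg0.
Qed.

End RhoBound.

(** * The independent Metropolis-Hastings chain *)

Section IndependentMetropolisHastings.
Context (R : realType) (f q : R -> R) (a : R).
Local Notation mu := (@lebesgue_measure R).
Hypotheses (mf : measurable_fun [set: R] f) (mq : measurable_fun [set: R] q).
Hypotheses (f0 : forall x, 0 <= f x) (q0 : forall x, 0 <= q x).
Hypotheses (f1 : (\int[mu]_x (f x)%:E = 1)%E) (q1 : (\int[mu]_x (q x)%:E = 1)%E).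
Hypotheses (a01 : 0 < a < 1) (aq : {ae mu, forall y, a * f y <= q y}).

Let accepted (z : R * R) := q z.2 * mh_acceptance f (fun _ => q) z.1 z.2.

Let good x := (0 < f x) && (a * f x <= q x).

Let accepted_ge0 z : 0 <= accepted z.
Proof. by rewrite mulr_ge0// le_min ler01 andbT divr_ge0// mulr_ge0. Qed.

Let accepted_le z : accepted z <= q z.2.
Proof. by rewrite ler_piMr// ge_min lexx orbT. Qed.

Let maccepted : measurable_fun [set: R * R] accepted.
Proof.
have mq1 : measurable_fun [set: R * R] (fun z => q z.1) by exact: measurableT_comp.
have mq2 : measurable_fun [set: R * R] (fun z => q z.2) by exact: measurableT_comp.
have mf1 : measurable_fun [set: R * R] (fun z => f z.1) by exact: measurableT_comp.
have mf2 : measurable_fun [set: R * R] (fun z => f z.2) by exact: measurableT_comp.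
apply: measurable_funM => //; apply: measurable_minr => //.
apply: measurable_funM; first exact: measurable_funM.
(* On nonnegative reals the inverse is a real power, which is measurable. *)
rewrite (_ : (fun z => _) = (fun z : R * R => (f z.1 * q z.2) `^ (-1))).
  by apply: (measurableT_comp (measurable_powR _)); exact: measurable_funM.
by apply/funext => z; rewrite powR_inv1// mulr_ge0.
Qed.

Let int_accepted x : (\int[mu]_y (accepted (x, y))%:E <= 1)%E.
Proof.
rewrite -q1; apply: ge0_le_integral => //.
- by move=> y _; rewrite lee_fin.
- by apply/measurable_EFinP; exact: measurableT_comp.
- exact/measurable_EFinP.
- by move=> y _; rewrite lee_fin; exact: (accepted_le (x, y)).
Qed.

Let accepted_minorization x y : good x -> a * f y <= q y ->
  a * f y <= accepted (x, y).
Proof.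
move=> /andP[fx0 aqx] aqy; rewrite /accepted /mh_acceptance /=.
have [qy0|qy0] := eqVneq (q y) 0; first by rewrite qy0 mul0r -[leRHS]qy0.
have qyp : 0 < q y by rewrite lt_neqAle eq_sym qy0 q0.
rewrite minEle; case: ifP => _; last by rewrite mulr1.
have -> : q y * (f y * q x / (f x * q y)) = f y * (q x / f x).
  by field; rewrite qy0 gt_eqF.
by rewrite mulrC ler_wpM2l// ler_pdivlMr.
Qed.

Let mgood : measurable_fun [set: R] good.
Proof.
apply: measurable_and; first exact: measurable_fun_ltr.
by apply: measurable_fun_ler => //; exact: measurable_funM.
Qed.

(** From a bad state the modified kernel moves with density [a * f] instead of
    the accepted density, which makes the minorization hold there as well. *)
Lemma mh_doeblin_kernel : exists2 K : R.-pker R ~> R,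
  (forall x C, measurable C -> a%:E * \int[mu]_(y in C) (f y)%:E <= K x C)%E &
  (forall x B, 0 < f x -> a * f x <= q x -> independent_mh_kernel f q x B = K x B).
Proof.
have /andP[/ltW a0 /ltW a1] := a01.
have mEf : measurable_fun [set: R] (fun y => (f y)%:E).
  exact/measurable_EFinP.
have afE C : measurable C ->
    (\int[mu]_(y in C) (a * f y)%:E = a%:E * \int[mu]_(y in C) (f y)%:E)%E.
  move=> mC; under eq_integral do rewrite EFinM.
  have fE0 y : C y -> (0 <= (f y)%:E)%E by rewrite lee_fin.
  by apply: (ge0_integralZl _ mC (measurable_funTS mEf) fE0); rewrite lee_fin.
pose g (z : R * R) := if good z.1 then accepted z else a * f z.2.
have mg : measurable_fun [set: R * R] g.
  apply: measurable_fun_ifT => //; first exact: measurableT_comp.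
  by apply: measurable_funM => //; exact: measurableT_comp.
have af0 y : 0 <= a * f y by rewrite mulr_ge0.
have g0 z : 0 <= g z by rewrite /g; case: ifP.
have g1 x : (\int[mu]_y (g (x, y))%:E <= 1)%E.
  rewrite /g /=; case gx : (good x); first exact: int_accepted.
  rewrite afE//.
  by rewrite f1 mule1 lee_fin.
have maf : measurable_fun [set: R] (fun y => (a * f y)%:E).
  by apply/measurable_EFinP; exact: measurable_funM.
have mgx x : measurable_fun [set: R] (fun y => (g (x, y))%:E).
  by apply/measurable_EFinP; exact: measurableT_comp.
have [K KE] := holding_kernel mg g0 g1; exists K.
  move=> x C mC; rewrite KE.
  apply: (@le_trans _ _ (\int[mu]_(y in C) (g (x, y))%:E)%E); last first.
    by rewrite leeDl//; apply: mule_ge0 => //; rewrite sube_ge0 ?orbT.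
  rewrite -afE//.
  apply: ae_ge0_le_integral => //.
  - by move=> y _; rewrite lee_fin; exact: af0.
  - exact: (measurable_funTS maf).
  - by move=> y _; rewrite lee_fin; exact: g0.
  - exact: (measurable_funTS (mgx x)).
  - have [N [mN N0 aqN]] := aq; exists N; split => // y /= ne.
    apply: aqN => aqy; apply: ne => _; rewrite lee_fin /g /=.
    by case: ifP => // gx; exact: accepted_minorization.
move=> x B fx0 aqx; rewrite KE /independent_mh_kernel /mh_kernel.
by rewrite /g /= /good fx0 aqx.
Qed.

Lemma measurable_independent_mh_kernel B : measurable B ->
  measurable_fun [set: R] (independent_mh_kernel f q ^~ B).
Proof.
have [K KE] := holding_kernel maccepted accepted_ge0 int_accepted.
move=> mB; rewrite (_ : independent_mh_kernel f q ^~ B = K ^~ B).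
  exact: measurable_kernel.
by apply/funext => x; rewrite KE.
Qed.

Lemma independent_mh_kernel_ge0 x B :
  (0 <= independent_mh_kernel f q x B)%E.
Proof.
apply: adde_ge0.
  by apply: integral_ge0 => y _; rewrite lee_fin; exact: (accepted_ge0 (x, y)).
by apply: mule_ge0 => //; rewrite sube_ge0 ?orbT// int_accepted.
Qed.

Let bad := [set x | ~~ good x].

Let mbad : measurable bad.
Proof.
rewrite (_ : bad = ~` (good @^-1` [set true])).
  by apply: measurableC; rewrite -[X in measurable X]setTI; exact: mgood.
by apply/seteqP; split => x /= /negP.
Qed.

Lemma integral_bad_state : (\int[mu]_(x in bad) (f x)%:E = 0)%E.
Proof.
rewrite (@ge0_ae_eq_integral _ _ _ mu bad _ (cst 0%E)) ?integral0//.
- by apply: measurable_funTS; exact/measurable_EFinP.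
- by move=> x _; rewrite lee_fin.
- have [N [mN N0 aqN]] := aq; exists N; split => // x /= ne.
  apply: aqN => aqx; apply: ne; rewrite /bad /= /good aqx andbT => /negP fx0.
  by congr EFin; apply/eqP; rewrite eq_le f0 andbT leNgt; exact/negP.
Qed.

Section Chain.
Context d (T : measurableType d) (P : probability T R).
Variable X : int -> {RV P >-> R}.
Hypothesis hX : stationary_markov_chain (independent_mh_kernel f q) f X.

(** The stationary chain is almost surely in a good state at any given time,
    hence it is also Markov for the modified kernel. *)
Lemma mh_chain_doeblin : exists K : R.-pker R ~> R,
  [/\ forall (n : int) (A : set T) (B : set R),
        sigma_of X [set i | i <= n] A -> measurable B ->
        P (A `&` X (n + 1) @^-1` B) = (\int[P]_(w in A) K (X n w) B)%E,
      forall n (B : set R), measurable B ->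
        distribution P (X n) B = distribution P (X 0) B &
      forall x C, measurable C -> (a%:E * distribution P (X 0%R) C <= K x C)%E].
Proof.
have [markov density] := hX.
have [K Kmin KE] := mh_doeblin_kernel; exists K; split.
- move=> n A B nA mB; rewrite markov//.
  have mA := sigma_of_measurable nA.
  apply: ge0_ae_eq_integral => //.
  + apply: measurable_funTS.
    exact: measurableT_comp (measurable_independent_mh_kernel mB) _.
  + apply: measurable_funTS.
    exact: measurableT_comp (measurable_kernel K B mB) _.
  + by move=> w _; exact: independent_mh_kernel_ge0.
  + exists (X n @^-1` bad); split.
    * exact: measurable_funPTI.
    * exact: etrans (density n bad mbad) integral_bad_state.
    * move=> w /= ne; apply/negP => /andP[fx aqx]; apply: ne => _.
      exact: KE.
- by move=> n B mB; rewrite !density.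
- by move=> x C mC; rewrite density//; exact: Kmin.
Qed.

End Chain.
End IndependentMetropolisHastings.

Lemma doeblin_rho_mixing d (T : measurableType d) (R : realType)
    (P : probability T R) (X : int -> {RV P >-> R}) (K : R.-pker R ~> R) (a : R) :
  (forall (n : int) (A : set T) (B : set R),
     sigma_of X [set i | i <= n] A -> measurable B ->
     P (A `&` X (n + 1) @^-1` B) = (\int[P]_(w in A) K (X n w) B)%E) ->
  (forall n (B : set R), measurable B ->
     distribution P (X n) B = distribution P (X 0) B) ->
  0 < a -> a < 1 ->
  (forall x C, measurable C -> (a%:E * distribution P (X 0%R) C <= K x C)%E) ->
  exponentially_rho_mixing X.
Proof.
move=> markov stationary a0 a1 minorization.
exists 1, (1 - a); split; first by rewrite subr_gt0 a1 gtrBl.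
move=> n _; rewrite mul1r; apply: rho_le_of_lower_bound.
  by rewrite exprn_ge0 ?exprn_ile1 ?subr_ge0 ?ltW// gtrBl.
move=> A H.
exact: past_future_lower_bound markov stationary _ a0 a1 minorization _ _ _.
Qed.

Theorem corollary5 (R : realType) (D : set R) (f q : R -> R) (a : R)
    (hf : positive_density_on D f) (hq : positive_density_on D q)
    (ha : 0 < a)
    (hqf : {ae @lebesgue_measure R, forall y, a * f y <= q y})
    (d : measure_display) (T : measurableType d) (P : probability T R)
    (X : int -> {RV P >-> R})
    (hX : stationary_markov_chain (independent_mh_kernel f q) f X) :
  geometrically_ergodic X /\ exponentially_rho_mixing X.
Proof.
have density_ge0 g : positive_density_on D g -> forall x, 0 <= g x.
  move=> [_ gpos gout _] x; have [/gpos/ltW//|/gout->//] := pselect (D x).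
have [f0 q0] := (density_ge0 f hf, density_ge0 q hq).
have [mf _ _ f1] := hf; have [mq _ _ q1] := hq.
(* The rate [1 - b] must be positive, whereas [a = 1] is possible (when
   [q = f] almost everywhere). *)
pose b := Num.min a 2^-1.
have b01 : 0 < b < 1.
  by rewrite lt_min ha invr_gt0 ltr0n /= gt_min invf_lt1 ?ltr1n ?orbT.
have bq : {ae @lebesgue_measure R, forall y, b * f y <= q y}.
  have [N [mN N0 aqN]] := hqf; exists N; split => // y /= ne.
  apply: aqN => aqy; apply: ne; apply: le_trans aqy.
  by rewrite ler_wpM2r// ge_min lexx.
have [K [markov stationary minorization]] :=
  mh_chain_doeblin mf mq f0 q0 f1 q1 b01 bq hX.
have /andP[b0 b1] := b01; split.
- exact: doeblin_geometrically_ergodic markov stationary b b0 b1 minorization.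
- exact: doeblin_rho_mixing markov stationary b0 b1 minorization.
Qed.
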